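(* Consider the linear regression loss $\ell(\theta,x,y)=(y-\langle\theta,x\rangle)^2$ and the transportation cost $c((x,y),(x',y'))=\|x-x'\|^2+\kappa(y-y')^2$, where $\kappa>0$. Let $F$ be the corresponding WDRO dual objective defined in the context. Define $$\widehat\Sigma:=\frac1n\sum_{i=1}^nx_ix_i^\top,\qquad\widehat r:=\frac1n\sum_{i=1}^ny_ix_i,\qquad\widehat\sigma_y^2:=\frac1n\sum_{i=1}^ny_i^2.$$ Assume that $\widehat r\ne0$, and set $$\delta_\kappa:=\frac{\|\widehat r\|}{\|\widehat\Sigma\|+\rho+\sqrt{\rho\kappa}\,\widehat\sigma_y}.$$ Then every minimizer $(\theta^\star,\lambda^\star)$ of $F$ satisfies $\|\theta^\star\|\ge\delta_\kappa$ and consequently, $$\lambda^\star\ge\kappa^{-1}+\delta_\kappa^2>0.$$ Moreover, every minimizer satisfies $$\lambda^\star\le\frac{\big(\widehat\sigma_y+\sqrt{\rho/\kappa}\big)^2}{\rho}.$$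
   Context: Setting. $\rho>0$; the parameter set $\Theta\subset\mathbb R^d$ is compact and convex; the sample space $\mathcal Z\subset\mathbb R^d\times\mathbb R$ is a Polish space of pairs $(x,y)$; the data points are $\xi_i=(x_i,y_i)\in\mathcal Z$, $i=1,\dots,n$. The WDRO dual objective is $$F(\theta,\lambda)=\frac1n\sum_{i=1}^n\ \sup_{(x,y)\in\mathcal Z}\Big\{\ell(\theta,x,y)+\lambda\big(\rho-c((x_i,y_i),(x,y))\big)\Big\},$$ with values in $(-\infty,+\infty]$, and minimizers are taken over $(\theta,\lambda)\in\Theta\times[0,\infty)$. $\|\cdot\|$ denotes the Euclidean norm on vectors and the associated operator norm on matrices, and $\widehat\sigma_y\ge0$.
   Formalization: Proved for sample space Z = R^d × R and for Θ containing the closed ball of radius δ_κ about 0; for general compact convex Θ (e.g. Θ = {0}) or general Z (e.g. Z = {ξ_1}, where λ* = 0) the claim is false. *)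

(* Defs.v *)
From mathcomp Require Import all_boot all_order all_algebra.
From mathcomp Require Import all_classical all_reals all_analysis.

Set Implicit Arguments.
Unset Strict Implicit.
Unset Printing Implicit Defensive.

Import Order.TTheory GRing.Theory Num.Theory.
Import numFieldNormedType.Exports.

Local Open Scope classical_set_scope.
Local Open Scope ring_scope.

Definition dotv (R : realType) (d : nat) (u v : 'cV[R]_d) : R :=
  \sum_(k < d) u k 0 * v k 0.

(* The library norm on matrices is the sup norm, so the Euclidean norm and the
   operator norm it induces are defined here.  Both norms on column vectors give
   the same topology, so [compact] has its usual meaning. *)
Definition enorm (R : realType) (d : nat) (v : 'cV[R]_d) : R :=
  Num.sqrt (\sum_(k < d) v k 0 ^+ 2).

Definition opnorm (R : realType) (d : nat) (A : 'M[R]_d) : R :=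
  sup [set enorm (A *m v) | v in [set v : 'cV[R]_d | enorm v <= 1]].

Section WDRO.
Context {R : realType} {d n : nat}.

(* Sample points (x, y). *)
Local Notation sample := ('cV[R]_d * R)%type.

(* [Z] is the sample space.  The supremum is taken in the extended reals, so
   the value is +oo as soon as one of the inner suprema is infinite. *)
Definition wdro_dual (Z : set sample) (loss : 'cV[R]_d -> sample -> R)
    (cost : sample -> sample -> R) (rho : R) (xi : 'I_n -> sample)
    (theta : 'cV[R]_d) (lambda : R) : \bar R :=
  ((n%:R^-1)%:E * \sum_(i < n) ereal_sup
     [set (loss theta z + lambda * (rho - cost (xi i) z))%:E | z in Z])%E.

Definition is_minimizer (Theta : set 'cV[R]_d) (F : 'cV[R]_d -> R -> \bar R)
    (theta : 'cV[R]_d) (lambda : R) : Prop :=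
  [/\ Theta theta, 0 <= lambda &
      forall theta' lambda', Theta theta' -> 0 <= lambda' ->
        (F theta lambda <= F theta' lambda')%E].

Definition sq_loss (theta : 'cV[R]_d) (z : sample) : R :=
  (z.2 - dotv theta z.1) ^+ 2.

Definition sq_cost (kappa : R) (z z' : sample) : R :=
  enorm (z.1 - z'.1) ^+ 2 + kappa * (z.2 - z'.2) ^+ 2.

Definition Sigma_hat (xi : 'I_n -> sample) : 'M[R]_d :=
  n%:R^-1 *: \sum_(i < n) (xi i).1 *m (xi i).1^T.

Definition r_hat (xi : 'I_n -> sample) : 'cV[R]_d :=
  n%:R^-1 *: \sum_(i < n) (xi i).2 *: (xi i).1.

Definition sigma_y_hat (xi : 'I_n -> sample) : R :=
  Num.sqrt (n%:R^-1 * \sum_(i < n) (xi i).2 ^+ 2).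

Definition delta_kappa (rho kappa : R) (xi : 'I_n -> sample) : R :=
  enorm (r_hat xi) /
    (opnorm (Sigma_hat xi) + rho + Num.sqrt (rho * kappa) * sigma_y_hat xi).

End WDRO.

(* Main.v *)
(* Write S = kappa^-1 + |theta|^2 and A for the empirical mean of the squared
   residuals at theta.  The dual value is +oo when lambda < S, and also when
   lambda = S and A <> 0; for lambda = S + t with t > 0 it equals
     S rho + A + t rho + S A / t.
   So lambda >= S at a minimizer.  If A = 0 then r_hat = Sigma_hat theta.
   Otherwise optimality in t gives t^2 rho = S A, and if theta is interior,
   optimality in theta at fixed t gives
     r_hat = Sigma_hat theta + (A / t) theta.
   Comparing (theta, lambda) with (0, lambda) yields A <= sigma_y^2, hence
   A / t = sqrt (rho A / S) <= sqrt (rho kappa) sigma_y, which bounds |r_hat|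
   by a multiple of |theta|.  The upper bound on lambda compares lambda rho
   with the minimum over t of the dual value at theta = 0. *)
Require Import Defs.
From mathcomp Require Import all_boot all_order all_algebra.
From mathcomp Require Import all_classical all_reals all_analysis.
From mathcomp Require Import ring lra.

Set Implicit Arguments.
Unset Strict Implicit.
Unset Printing Implicit Defensive.

Import Order.TTheory GRing.Theory Num.Theory.
Import numFieldNormedType.Exports.

Local Open Scope classical_set_scope.
Local Open Scope ring_scope.

(** * Euclidean inner product, norm and operator norm *)

Section Euclidean.
Context {R : realType} {d : nat}.
Implicit Types u v w : 'cV[R]_d.

Lemma dotvC u v : dotv u v = dotv v u.
Proof. by apply: eq_bigr => k _; rewrite mulrC. Qed.

Lemma dotvDl u v w : dotv (u + v) w = dotv u w + dotv v w.
Proof. by rewrite -big_split; apply: eq_bigr => k _; rewrite mxE mulrDl. Qed.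

Lemma dotvZl a u w : dotv (a *: u) w = a * dotv u w.
Proof. by rewrite mulr_sumr; apply: eq_bigr => k _; rewrite mxE mulrA. Qed.

Lemma dotvDr w u v : dotv w (u + v) = dotv w u + dotv w v.
Proof. by rewrite dotvC dotvDl !(dotvC w). Qed.

Lemma dotvZr a w u : dotv w (a *: u) = a * dotv w u.
Proof. by rewrite dotvC dotvZl dotvC. Qed.

Lemma dotvNr w u : dotv w (- u) = - dotv w u.
Proof. by rewrite -scaleN1r dotvZr mulN1r. Qed.

Lemma dotv0l u : dotv 0 u = 0.
Proof. by rewrite -(scale0r 0) dotvZl mul0r. Qed.

Lemma dotv0r u : dotv u 0 = 0.
Proof. by rewrite dotvC dotv0l. Qed.

Lemma dotv_sumr (I : finType) w (f : I -> 'cV[R]_d) :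
  dotv w (\sum_i f i) = \sum_i dotv w (f i).
Proof.
by elim/big_rec2: _ => [|i y x _ <-]; rewrite ?dotv0r ?dotvDr.
Qed.

Lemma dotvv_ge0 u : 0 <= dotv u u.
Proof. by apply: sumr_ge0 => k _; rewrite -expr2 sqr_ge0. Qed.

Lemma dotvv_eq0 u : dotv u u = 0 -> u = 0.
Proof.
move=> /eqP; rewrite psumr_eq0 => [/allP u0|k _]; last by rewrite -expr2 sqr_ge0.
apply/colP => k; rewrite mxE.
by have /eqP := u0 k (mem_index_enum k); rewrite -expr2 => /eqP; rewrite sqrf_eq0 => /eqP.
Qed.

Lemma enormE u : enorm u = Num.sqrt (dotv u u).
Proof. by congr Num.sqrt; apply: eq_bigr => k _; rewrite expr2. Qed.

Lemma enorm_ge0 u : 0 <= enorm u.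
Proof. exact: sqrtr_ge0. Qed.

Lemma sqr_enorm u : enorm u ^+ 2 = dotv u u.
Proof. by rewrite enormE sqr_sqrtr ?dotvv_ge0. Qed.

Lemma enorm0 : enorm (0 : 'cV[R]_d) = 0.
Proof. by rewrite enormE dotv0l sqrtr0. Qed.

Lemma enormZ a u : enorm (a *: u) = `|a| * enorm u.
Proof.
by rewrite !enormE dotvZl dotvZr mulrA -expr2 sqrtrM ?sqr_ge0// sqrtr_sqr.
Qed.

Lemma enorm_gt0 u : u != 0 -> 0 < enorm u.
Proof.
move=> u0; rewrite lt_neqAle enorm_ge0 andbT eq_sym; apply: contra u0 => /eqP e0.
by apply/eqP/dotvv_eq0; rewrite -sqr_enorm e0 expr0n.
Qed.

Lemma Cauchy_Schwarz_dotv u v : dotv u v ^+ 2 <= dotv u u * dotv v v.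
Proof.
have [v0|v0] := eqVneq (dotv v v) 0.
  by rewrite (dotvv_eq0 v0) !dotv0r expr0n mulr0.
have vgt0 : 0 < dotv v v by rewrite lt_neqAle eq_sym v0 dotvv_ge0.
(* Up to the factor [dotv v v], this is the component of [u] orthogonal to [v]. *)
have := dotvv_ge0 (dotv v v *: u - dotv u v *: v).
rewrite -scaleNr !(dotvDl, dotvDr, dotvZl, dotvZr) (dotvC v u) => h.
rewrite -subr_ge0 -(pmulr_rge0 _ vgt0); lra.
Qed.

Lemma ler_enormD u v : enorm (u + v) <= enorm u + enorm v.
Proof.
have cs : dotv u v <= enorm u * enorm v.
  apply: le_trans (ler_norm _) _.
  rewrite -[leLHS]ger0_norm// -ler_sqr ?nnegrE ?mulr_ge0 ?enorm_ge0 ?normr_ge0//.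
  by rewrite normr_id real_normK ?num_real// exprMn !sqr_enorm Cauchy_Schwarz_dotv.
rewrite -ler_sqr ?nnegrE ?addr_ge0 ?enorm_ge0// sqrrD !sqr_enorm.
rewrite dotvDl !dotvDr (dotvC v u); lra.
Qed.

(** The Frobenius norm bounds the set, by Cauchy-Schwarz on each row. *)
Lemma opnorm_ubound (A : 'M[R]_d) :
  has_ubound [set enorm (A *m v) | v in [set v : 'cV[R]_d | enorm v <= 1]].
Proof.
exists (Num.sqrt (\sum_k dotv (row k A)^T (row k A)^T)) => _ [v /= v1 <-].
rewrite /enorm ler_wsqrtr//; apply: ler_sum => k _.
have -> : (A *m v) k 0 = dotv (row k A)^T v.
  by rewrite mxE; apply: eq_bigr => j _; rewrite !mxE.
apply: le_trans (Cauchy_Schwarz_dotv _ _) _.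
rewrite ler_piMr ?dotvv_ge0// -sqr_enorm.
by rewrite expr_le1 ?enorm_ge0.
Qed.

Lemma enorm_mulmx (A : 'M[R]_d) v : enorm (A *m v) <= opnorm A * enorm v.
Proof.
have [->|v0] := eqVneq v 0; first by rewrite mulmx0 enorm0 mulr0.
have nv := enorm_gt0 v0.
rewrite -ler_pdivrMr//.
have -> : enorm (A *m v) / enorm v = enorm (A *m ((enorm v)^-1 *: v)).
  by rewrite -scalemxAr enormZ ger0_norm ?invr_ge0 ?enorm_ge0 // mulrC.
apply: ub_le_sup; first exact: opnorm_ubound.
exists ((enorm v)^-1 *: v) => //=.
by rewrite enormZ ger0_norm ?invr_ge0 ?enorm_ge0 // mulVf// gt_eqF.
Qed.

Lemma opnorm_ge0 (A : 'M[R]_d) : 0 <= opnorm A.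
Proof.
apply: ub_le_sup; first exact: opnorm_ubound.
by exists 0 => /=; rewrite ?enorm0 ?ler01 ?mulmx0 ?enorm0.
Qed.

End Euclidean.

(** A negative [c1] would dominate the higher powers for small [e]. *)
Lemma le0_first_order (R : realFieldType) (e0 c1 c2 c3 c4 : R) :
  0 < e0 ->
  (forall e, 0 < e -> e <= e0 ->
     0 <= c1 * e + c2 * e ^+ 2 + c3 * e ^+ 3 + c4 * e ^+ 4) ->
  0 <= c1.
Proof.
move=> e0_gt0 h; rewrite leNgt; apply/negP => c1_lt0.
pose K := `|c2| + `|c3| + `|c4| + 1.
have K_gt0 : 0 < K by rewrite ltr_wpDl ?addr_ge0.
(* [e <= 1] bounds the bracket of higher terms by [e * K], and the last entry makes this at most
   [- c1 / 2]. *)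
pose e := Num.min e0 (Num.min 1 (- c1 / (2 * K))).
have e_gt0 : 0 < e.
  by rewrite !lt_min e0_gt0 ltr01 divr_gt0 ?oppr_gt0 ?mulr_gt0.
have ee0 : e <= e0 by rewrite ge_min lexx.
have e1 : e <= 1 by rewrite !ge_min lexx orbT.
have eK : e * K <= - c1 / 2.
  have : e <= - c1 / (2 * K) by rewrite !ge_min lexx !orbT.
  by rewrite invfM mulrA ler_pdivlMr.
have e2_ge0 : 0 <= e ^+ 2 by exact: sqr_ge0.
have e21 : e ^+ 2 <= 1 by rewrite expr_le1 ?(ltW e_gt0).
have b2 : c2 <= `|c2| := ler_norm _.
have b3 : c3 * e <= `|c3|.
  apply: le_trans (ler_norm _) _.
  by rewrite normrM (gtr0_norm e_gt0) ler_piMr.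
have b4 : c4 * e ^+ 2 <= `|c4|.
  apply: le_trans (ler_norm _) _.
  by rewrite normrM (ger0_norm e2_ge0) ler_piMr.
have b : e * (c2 + c3 * e + c4 * e ^+ 2) <= e * K.
  by rewrite ler_pM2l// /K; lra.
have := h e e_gt0 ee0.
have -> : c1 * e + c2 * e ^+ 2 + c3 * e ^+ 3 + c4 * e ^+ 4 =
  e * (c1 + e * (c2 + c3 * e + c4 * e ^+ 2)) by ring.
by rewrite pmulr_rge0// leNgt => /negP; apply; lra.
Qed.

(** * Empirical means and quadratic expansions *)

Section Regression.
Context {R : realType} {d n : nat}.
Variables (rho kappa : R) (xi : 'I_n -> 'cV[R]_d * R).
Hypotheses (n_gt0 : (0 < n)%N) (rho_gt0 : 0 < rho) (kappa_gt0 : 0 < kappa).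
Implicit Types theta w : 'cV[R]_d.

Local Notation F := (wdro_dual setT sq_loss (sq_cost kappa) rho xi).

Definition residual theta (i : 'I_n) : R := (xi i).2 - dotv theta (xi i).1.

Definition mean (f : 'I_n -> R) : R := n%:R^-1 * \sum_i f i.

Definition mse theta : R := mean (fun i => residual theta i ^+ 2).

(** The squared dual norm of the linear form [(x, y) |-> y - dotv theta x] for the norm with square
    [|x|^2 + kappa y^2]. *)
Definition spread theta : R := kappa^-1 + dotv theta theta.

Let nV_gt0 : 0 < n%:R^-1 :> R.
Proof. by rewrite invr_gt0 ltr0n. Qed.

Lemma meanD f g : mean (fun i => f i + g i) = mean f + mean g.
Proof. by rewrite /mean big_split mulrDr. Qed.

Lemma meanZ a f : mean (fun i => a * f i) = a * mean f.
Proof. by rewrite /mean -mulr_sumr mulrCA. Qed.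

Lemma mean_cst a : mean (fun=> a) = a.
Proof.
by rewrite /mean sumr_const card_ord -[a *+ n]mulr_natl mulrA mulVf ?mul1r// pnatr_eq0 -lt0n.
Qed.

Lemma eq_mean f g : f =1 g -> mean f = mean g.
Proof. by move=> fg; rewrite /mean; congr (_ * _); apply: eq_bigr. Qed.

Lemma mean_ge0 f : (forall i, 0 <= f i) -> 0 <= mean f.
Proof. by move=> f0; rewrite mulr_ge0 ?sumr_ge0 // ltW. Qed.

Lemma mean_sqr_eq0 f : mean (fun i => f i ^+ 2) = 0 -> forall i, f i = 0.
Proof.
move=> /eqP; rewrite mulf_eq0 gt_eqF//= psumr_eq0 => [/allP f0 i|i _]; last exact: sqr_ge0.
by have := f0 i (mem_index_enum i); rewrite sqrf_eq0 => /eqP.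
Qed.

Lemma spread_ge theta : kappa^-1 <= spread theta.
Proof. by rewrite lerDl dotvv_ge0. Qed.

Lemma spread_gt0 theta : 0 < spread theta.
Proof. by apply: lt_le_trans (spread_ge theta); rewrite invr_gt0. Qed.

Lemma mse_ge0 theta : 0 <= mse theta.
Proof. by apply: mean_ge0 => i; exact: sqr_ge0. Qed.

Lemma spread0 : spread 0 = kappa^-1.
Proof. by rewrite /spread dotv0l addr0. Qed.

Lemma mse0 : mse 0 = sigma_y_hat xi ^+ 2.
Proof.
rewrite sqr_sqrtr; last first.
  by rewrite mulr_ge0 ?(ltW nV_gt0) ?sumr_ge0// => i _; exact: sqr_ge0.
by apply: eq_mean => i; rewrite /residual dotv0l subr0.
Qed.

Lemma spreadD theta w e :
  spread (theta + e *: w) =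
  spread theta + 2 * e * dotv theta w + e ^+ 2 * dotv w w.
Proof.
by rewrite /spread !(dotvDl, dotvDr, dotvZl, dotvZr) (dotvC w theta); ring.
Qed.

(** Both sides are minus half the derivative of [mse] at [theta] in direction [w]. *)
Lemma mean_residual theta w :
  mean (fun i => residual theta i * dotv w (xi i).1) =
  dotv w (r_hat xi - Sigma_hat xi *m theta).
Proof.
rewrite /r_hat /Sigma_hat -scalemxAl -scalerBr dotvZr; congr (_ * _).
rewrite mulmx_suml -sumrB dotv_sumr; apply: eq_bigr => i _.
have -> : (xi i).1 *m (xi i).1^T *m theta = dotv theta (xi i).1 *: (xi i).1.
  rewrite -mulmxA; apply/colP => k; rewrite !mxE big_ord1 !mxE mulrC.
  by congr (_ * _); apply: eq_bigr => j _; rewrite !mxE mulrC.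
by rewrite -scalerBl dotvZr.
Qed.

Lemma mseD theta w e :
  mse (theta + e *: w) =
  mse theta + 2 * e * dotv w (Sigma_hat xi *m theta - r_hat xi) +
  e ^+ 2 * mean (fun i => dotv w (xi i).1 ^+ 2).
Proof.
rewrite -(opprB (r_hat xi)) dotvNr -mean_residual mulrN -mulNr -!meanZ -!meanD.
by apply: eq_mean => i; rewrite /residual dotvDl dotvZl; ring.
Qed.

(** All residuals vanish, hence so does the gradient of [mse]: these are the normal equations. *)
Lemma mse_eq0 theta : mse theta = 0 -> r_hat xi = Sigma_hat xi *m theta.
Proof.
move=> /mean_sqr_eq0 r0; apply/eqP; rewrite -subr_eq0; apply/eqP/dotvv_eq0.
rewrite -mean_residual -(mean_cst 0).
by apply: eq_mean => i; rewrite r0 mul0r.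
Qed.

Lemma sigma_y_hat_gt0 : r_hat xi != 0 -> 0 < sigma_y_hat xi.
Proof.
move=> r0; rewrite lt_neqAle sqrtr_ge0 andbT eq_sym; apply: contra r0 => /eqP s0.
by rewrite (@mse_eq0 0) ?mulmx0// mse0 s0 expr0n.
Qed.

(** * Two-sided bounds on the dual objective *)

Lemma wdro_dual_ge theta lambda (z : 'I_n -> 'cV[R]_d * R) :
  ((mean (fun i => sq_loss theta (z i) +
      lambda * (rho - sq_cost kappa (xi i) (z i))))%:E <= F theta lambda)%E.
Proof.
rewrite /wdro_dual EFinM lee_pmul2l ?lte_fin// -sumEFin; apply: lee_sum => i _.
by apply: ereal_sup_ubound; exists (z i).
Qed.

Lemma wdro_dual_le theta lambda (B : 'I_n -> R) :
  (forall i z, sq_loss theta z + lambda * (rho - sq_cost kappa (xi i) z) <= B i) ->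
  (F theta lambda <= (mean B)%:E)%E.
Proof.
move=> hB; rewrite /wdro_dual EFinM lee_pmul2l ?lte_fin// -sumEFin.
apply: lee_sum => i _; apply: ge_ereal_sup => _ [z _ <-].
by rewrite lee_fin.
Qed.

(* Each sample is moved in the direction [(- theta, kappa^-1)], in which the
   residual grows fastest relative to the cost. *)
Lemma wdro_dual_ge_shift theta lambda (a : 'I_n -> R) :
  ((lambda * rho + mean (fun i => (residual theta i + a i * spread theta) ^+ 2
      - lambda * (a i ^+ 2 * spread theta)))%:E <= F theta lambda)%E.
Proof.
pose z i := ((xi i).1 - a i *: theta, (xi i).2 + a i / kappa).
apply: le_trans (wdro_dual_ge theta lambda z).
rewrite lee_fin -[lambda * rho]mean_cst -meanD le_eqVlt; apply/orP; left; apply/eqP.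
apply: eq_mean => i; rewrite /sq_loss /sq_cost /= subKr sqr_enorm.
rewrite !(dotvDl, dotvDr, dotvNr, dotvZl, dotvZr) /residual /spread.
by field; rewrite gt_eqF.
Qed.

(* Cauchy-Schwarz for the inner product with norm [|u|^2 + kappa v^2]. *)
Lemma Cauchy_Schwarz_spread theta w v :
  (v - dotv theta w) ^+ 2 <= spread theta * (dotv w w + kappa * v ^+ 2).
Proof.
have cs := Cauchy_Schwarz_dotv theta w.
have h : 0 <= kappa^-1 * dotv (kappa * v *: theta + w) (kappa * v *: theta + w).
  by rewrite mulr_ge0 ?dotvv_ge0// invr_ge0 ltW.
(* The slack splits into a square and the defect of the usual Cauchy-Schwarz inequality. *)
suff : spread theta * (dotv w w + kappa * v ^+ 2) - (v - dotv theta w) ^+ 2 =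
  kappa^-1 * dotv (kappa * v *: theta + w) (kappa * v *: theta + w) +
  (dotv theta theta * dotv w w - dotv theta w ^+ 2) by lra.
rewrite !(dotvDl, dotvDr, dotvZl, dotvZr) (dotvC w theta) /spread.
by field; rewrite gt_eqF.
Qed.

(** Changing a residual from [r] to [r + s] costs at least [s ^+ 2 / S]; maximising over [s] gives
    the bound. *)
Lemma wdro_dual_le_closed theta t : 0 < t ->
  (F theta (spread theta + t) <=
    ((spread theta + t) * rho + (spread theta + t) / t * mse theta)%:E)%E.
Proof.
move=> t_gt0; set S := spread theta.
have S_gt0 : 0 < S := spread_gt0 theta.
rewrite -[(S + t) * rho]mean_cst -meanZ -meanD.
apply: wdro_dual_le => i [x y]; rewrite /sq_loss /sq_cost /= -(opprB x) -(opprB y).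
rewrite -[- (x - _)]scaleN1r enormZ normrN1 mul1r sqrrN sqr_enorm.
set u := x - (xi i).1; set v := y - (xi i).2; set r := residual theta i.
have -> : y - dotv theta x = r + (v - dotv theta u).
  by rewrite /r /residual /u /v dotvDr dotvNr; ring.
have := Cauchy_Schwarz_spread theta u v.
rewrite -/S; set s := v - _; set c := _ + kappa * _ => cs.
have cs' : (S + t) * (s ^+ 2 / S) <= (S + t) * c.
  by rewrite ler_pM2l ?(addr_gt0 S_gt0 t_gt0)// ler_pdivrMr// mulrC.
(* The completed square: the maximum over [s] minus the value at [s]. *)
have : 0 <= (r * S - s * t) ^+ 2 / (S * t) by rewrite divr_ge0 ?sqr_ge0// ltW ?mulr_gt0.
have -> : (r * S - s * t) ^+ 2 / (S * t) =
  (S + t) / t * r ^+ 2 - (r + s) ^+ 2 + (S + t) * (s ^+ 2 / S).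
  by field; rewrite !gt_eqF.
lra.
Qed.

(** * Consequences of minimality *)

Section Minimizer.
Variables (Theta : set 'cV[R]_d) (theta : 'cV[R]_d) (lambda : R).
Hypothesis minF : is_minimizer Theta F theta lambda.
Hypothesis Theta0 : Theta 0.

Local Notation S := (spread theta).
Local Notation A := (mse theta).

Lemma minimizer_shift_le theta' t (a : 'I_n -> R) : Theta theta' -> 0 < t ->
  lambda * rho +
    mean (fun i => (residual theta i + a i * S) ^+ 2 - lambda * (a i ^+ 2 * S))
  <= (spread theta' + t) * rho + (spread theta' + t) / t * mse theta'.
Proof.
move=> Th t_gt0; rewrite -lee_fin; have [_ _ minF'] := minF.
apply: le_trans (wdro_dual_ge_shift theta lambda a) _.
apply: le_trans (wdro_dual_le_closed theta' t_gt0).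
by apply: minF' => //; rewrite addr_ge0// ltW// spread_gt0.
Qed.

(** If [lambda < S], shifts of size [b] gain at order [b ^+ 2], without bound. *)
Lemma minimizer_spread_le : S <= lambda.
Proof.
have S_gt0 := spread_gt0 theta.
rewrite leNgt; apply/negP => ltS.
set M := (spread 0 + 1) * rho + (spread 0 + 1) / 1 * mse 0.
(* Averaging the shifts [b] and [- b] cancels the term linear in [b]. *)
have bnd b : b ^+ 2 * (S * (S - lambda)) <= M - lambda * rho.
  have hp := minimizer_shift_le (fun=> b) Theta0 ltr01.
  have hm := minimizer_shift_le (fun=> - b) Theta0 ltr01.
  have e : mean (fun i => (residual theta i + b * S) ^+ 2 - lambda * (b ^+ 2 * S)) +
      mean (fun i => (residual theta i + - b * S) ^+ 2 - lambda * ((- b) ^+ 2 * S)) =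
      2 * A + 2 * (b ^+ 2 * (S * (S - lambda))).
    rewrite -meanD -meanZ -[2 * (b ^+ 2 * _)]mean_cst -meanD.
    by apply: eq_mean => i; ring.
  have := mse_ge0 theta; rewrite -/M in hp hm; lra.
set c := S * (S - lambda) in bnd.
have c_gt0 : 0 < c by rewrite mulr_gt0// subr_gt0.
have M_ge0 : 0 <= M - lambda * rho by have := bnd 0; rewrite expr0n mul0r.
(* This [b] makes [b ^+ 2 * c] exceed [M - lambda * rho]. *)
have := bnd (1 + (M - lambda * rho) / c).
set m := M - lambda * rho in M_ge0 *.
have -> : (1 + m / c) ^+ 2 * c = m + (c + m + m ^+ 2 / c).
  by field; rewrite gt_eqF.
by have : 0 <= m ^+ 2 / c; [rewrite divr_ge0 ?sqr_ge0// ltW|lra].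
Qed.

(** At [lambda = S] the terms quadratic in the shift cancel; shifts proportional to the residuals
    then gain linearly, without bound unless [A = 0]. *)
Lemma minimizer_mse_eq0 : lambda = S -> A = 0.
Proof.
move=> lS; have S_gt0 := spread_gt0 theta; apply/eqP; rewrite eq_le mse_ge0 andbT.
set M := (spread 0 + 1) * rho + (spread 0 + 1) / 1 * mse 0.
rewrite leNgt; apply/negP => A_gt0.
have bnd b : (1 + 2 * b * S) * A <= M - lambda * rho.
  have := minimizer_shift_le (fun i => b * residual theta i) Theta0 ltr01.
  rewrite -/M -lerBrDl -meanZ; apply: le_trans.
  rewrite le_eqVlt; apply/orP; left; apply/eqP/eq_mean => i.
  by rewrite lS; ring.
(* For this [b] the bound reads [A + m <= m]. *)
have := bnd ((M - lambda * rho) / (2 * S * A)).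
set m := M - lambda * rho.
have -> : (1 + 2 * (m / (2 * S * A)) * S) * A = A + m.
  by field; rewrite !gt_eqF.
lra.
Qed.

(** The shift [residual theta i / (lambda - S)] maximises the lower bound and attains the closed
    form. *)
Lemma minimizer_closed_le theta' t : S < lambda -> Theta theta' -> 0 < t ->
  lambda * rho + lambda / (lambda - S) * A <=
  (spread theta' + t) * rho + (spread theta' + t) / t * mse theta'.
Proof.
move=> ltS Th t_gt0.
apply: le_trans (minimizer_shift_le
  (fun i => residual theta i / (lambda - S)) Th t_gt0).
rewrite lerD2l -meanZ le_eqVlt; apply/orP; left; apply/eqP/eq_mean => i.
by field; rewrite gt_eqF// subr_gt0.
Qed.

(* [theta] is compared with [0] at the same [lambda]. *)
Lemma minimizer_mse_le : S < lambda -> A <= sigma_y_hat xi ^+ 2.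
Proof.
move=> ltS; have kS := spread_ge theta.
have t_gt0 : 0 < lambda - S by rewrite subr_gt0.
have k_gt0 : 0 < kappa^-1 by rewrite invr_gt0.
have u_gt0 : 0 < lambda - kappa^-1 by lra.
have l_gt0 : 0 < lambda by lra.
have := minimizer_closed_le ltS Theta0 u_gt0.
rewrite spread0 mse0 subrKC lerD2l -!mulrA ler_pM2l// => h.
have : A <= (lambda - S) * ((lambda - kappa^-1)^-1 * sigma_y_hat xi ^+ 2).
  by rewrite -ler_pdivrMl.
move/le_trans; apply; rewrite mulrA ler_piMl ?sqr_ge0//.
by rewrite ler_pdivrMr// mul1r; lra.
Qed.

(* Optimality in [lambda] at fixed [theta]. *)
Lemma minimizer_gap : S < lambda -> Theta theta -> 0 < A ->
  (lambda - S) ^+ 2 * rho = S * A.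
Proof.
move=> ltS Th A_gt0; have S_gt0 := spread_gt0 theta.
have t_gt0 : 0 < lambda - S by rewrite subr_gt0.
set t := lambda - S in t_gt0 *.
have SAr_gt0 : 0 < S * A / rho by rewrite divr_gt0// mulr_gt0.
(* The minimizer of [t * rho + S * A / t] over [t > 0]. *)
set t' := Num.sqrt (S * A / rho).
have t'_gt0 : 0 < t' by rewrite sqrtr_gt0.
have t'E : S * A = t' ^+ 2 * rho by rewrite sqr_sqrtr ?ltW// mulfVK// gt_eqF.
have := minimizer_closed_le ltS Th t'_gt0.
have -> : lambda = S + t by rewrite /t; ring.
have -> : S + t - S = t by ring.
have -> : (S + t) * rho + (S + t) / t * A = S * rho + A + (t * rho + S * A / t).
  by field; rewrite gt_eqF.
have -> : (S + t') * rho + (S + t') / t' * A = S * rho + A + (t' * rho + S * A / t').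
  by field; rewrite gt_eqF.
rewrite lerD2l t'E -subr_le0.
(* The excess over the minimum is a multiple of a square, so it vanishes only at [t = t']. *)
have -> : t * rho + t' ^+ 2 * rho / t - (t' * rho + t' ^+ 2 * rho / t') =
  rho / t * (t - t') ^+ 2 by field; rewrite !gt_eqF.
rewrite pmulr_rle0 ?divr_gt0// => h.
have /eqP : (t - t') ^+ 2 = 0 by apply/eqP; rewrite eq_le h sqr_ge0.
by rewrite sqrf_eq0 subr_eq0 => /eqP ->.
Qed.

(* Stationarity in [theta] with the gap [lambda - S], rather than [lambda], held
   fixed: along a line the objective is then a quartic polynomial. *)
Lemma minimizer_gradient delta : S < lambda -> enorm theta < delta ->
  (forall theta', enorm theta' <= delta -> Theta theta') ->
  (rho * (lambda - S) + A) *: theta + lambda *: (Sigma_hat xi *m theta - r_hat xi)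
  = 0.
Proof.
move=> ltS th_lt ball; have S_gt0 := spread_gt0 theta.
have t_gt0 : 0 < lambda - S by rewrite subr_gt0.
set g := _ + _; set t := lambda - S in t_gt0 g *.
(* Along [- g] the first-order coefficient is [-2 |g|^2]; its nonnegativity forces [g = 0]. *)
pose w := - g.
pose b := dotv w w.
pose q := dotv w (Sigma_hat xi *m theta - r_hat xi).
pose a := dotv theta w.
pose p := mean (fun i => dotv w (xi i).1 ^+ 2).
suff : 0 <= 2 * dotv w g.
  rewrite /w -scaleN1r dotvZl mulN1r => h.
  by apply: dotvv_eq0; apply/eqP; rewrite eq_le dotvv_ge0 andbT; lra.
have w1_gt0 : 0 < enorm w + 1 by rewrite ltr_wpDl ?enorm_ge0.
(* The range of [e] keeps [theta + e *: w] in the ball of radius [delta], with [+ 1] covering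
   [w = 0]; the coefficients expand [lambda - S] times the increase of the objective. *)
apply: (@le0_first_order _ ((delta - enorm theta) / (enorm w + 1)) _
  (rho * t * b + t * p + S * p + A * b + 4 * a * q)
  (2 * a * p + 2 * b * q) (b * p)).
  by rewrite divr_gt0// subr_gt0.
move=> e e_gt0; rewrite ler_pdivlMr// => e_le.
have Th' : Theta (theta + e *: w).
  apply: ball; apply: le_trans (ler_enormD _ _) _.
  by rewrite enormZ gtr0_norm//; lra.
have := minimizer_closed_le ltS Th' t_gt0.
rewrite spreadD mseD -/a -/b -/q -/p -/t -subr_ge0 -(pmulr_rge0 _ t_gt0).
have -> : dotv w g = (rho * t + A) * a + (S + t) * q.
  by rewrite /g dotvDr !dotvZr (dotvC w theta) /t subrKC.
have lE : lambda = S + t by rewrite /t subrKC.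
rewrite lE; congr (0 <= _).
by field; rewrite gt_eqF.
Qed.

Lemma minimizer_norm_ge : r_hat xi != 0 ->
  (forall theta', enorm theta' <= delta_kappa rho kappa xi -> Theta theta') ->
  delta_kappa rho kappa xi <= enorm theta.
Proof.
move=> r0 ball; have S_gt0 := spread_gt0 theta.
(* The goal is restored with [th_lt] as an extra hypothesis, which puts [theta] inside the ball,
   where stationarity holds. *)
rewrite leNgt; apply/negP => th_lt; move: (th_lt); apply/negP; rewrite -leNgt.
have op0 := opnorm_ge0 (Sigma_hat xi).
have sk0 : 0 <= Num.sqrt (rho * kappa) * sigma_y_hat xi.
  by rewrite mulr_ge0// sqrtr_ge0.
have th0 := enorm_ge0 theta.
have D_gt0 : 0 < opnorm (Sigma_hat xi) + rho + Num.sqrt (rho * kappa) * sigma_y_hat xi.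
  by rewrite ltr_wpDr// ltr_wpDl.
rewrite ler_pdivrMr//; move: sk0 D_gt0.
set sk := Num.sqrt _ * _ => sk0 D_gt0.
have le_op := enorm_mulmx (Sigma_hat xi) theta.
have Th : Theta theta by case: minF.
(* A ridge form of the normal equations; the triangle inequality then bounds the norm of
   [r_hat xi]. *)
suff : exists2 c, c <= sk &
    0 <= c /\ r_hat xi = Sigma_hat xi *m theta + c *: theta.
  case=> c c_le [c_ge0 rE].
  have := ler_enormD (Sigma_hat xi *m theta) (c *: theta).
  rewrite -rE (enormZ c) ger0_norm// => h.
  have : c * enorm theta <= sk * enorm theta by rewrite ler_wpM2r.
  have : 0 <= rho * enorm theta by rewrite mulr_ge0// ltW.
  lra.
have [A0|An0] := eqVneq A 0.
  by exists 0 => //; split=> //; rewrite scale0r addr0 (mse_eq0 A0).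
have A_gt0 : 0 < A by rewrite lt_neqAle eq_sym An0 mse_ge0.
have ltS : S < lambda.
  rewrite lt_neqAle minimizer_spread_le andbT; apply: contraNneq An0 => Sl.
  by rewrite minimizer_mse_eq0.
have t_gt0 : 0 < lambda - S by rewrite subr_gt0.
have l_gt0 : 0 < lambda by lra.
have gap := minimizer_gap ltS Th A_gt0.
have grad := minimizer_gradient ltS th_lt ball.
have A_le := minimizer_mse_le ltS.
(* By [gap], the square of this coefficient is [rho * (A / S)], at most
   [rho * kappa * sigma_y_hat xi ^+ 2]. *)
exists (A / (lambda - S)); last split.
- have c_ge0 : 0 <= A / (lambda - S) by rewrite divr_ge0// ltW.
  rewrite -ler_sqr ?nnegrE// [leRHS]exprMn sqr_sqrtr; last exact/ltW/mulr_gt0.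
  have -> : (A / (lambda - S)) ^+ 2 = rho * (A / S).
    rewrite exprMn exprVn; apply: (mulIf (lt0r_neq0 (exprn_gt0 2 t_gt0))).
    rewrite mulfVK ?lt0r_neq0 ?exprn_gt0//.
    have -> : rho * (A / S) * (lambda - S) ^+ 2 = (lambda - S) ^+ 2 * rho * (A / S) by ring.
    by rewrite gap; field; rewrite gt_eqF.
  rewrite -[leRHS]mulrA ler_pM2l// ler_pdivrMr//.
  have kS : 1 <= kappa * S.
    by rewrite -(divff (lt0r_neq0 kappa_gt0)) ler_pM2l// spread_ge.
  apply: (le_trans A_le).
  have -> : kappa * sigma_y_hat xi ^+ 2 * S = (kappa * S) * sigma_y_hat xi ^+ 2 by ring.
  by rewrite ler_peMl// sqr_ge0.
- by rewrite divr_ge0// ltW.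
(* By [gap], [lambda] is a common factor of the stationarity equation and can be divided out. *)
have cE : rho * (lambda - S) + A = lambda * (A / (lambda - S)).
  apply: (mulIf (lt0r_neq0 t_gt0)).
  have -> : (rho * (lambda - S) + A) * (lambda - S) =
    (lambda - S) ^+ 2 * rho + A * (lambda - S) by ring.
  by rewrite gap mulrA mulfVK ?lt0r_neq0//; ring.
move: grad; rewrite cE -scalerA -scalerDr => /eqP.
by rewrite scaler_eq0 gt_eqF//= addrA subr_eq0 addrC => /eqP.
Qed.

Lemma minimizer_lambda_le : r_hat xi != 0 ->
  lambda <= (sigma_y_hat xi + Num.sqrt (rho / kappa)) ^+ 2 / rho.
Proof.
move=> /sigma_y_hat_gt0 s_gt0; set s := sigma_y_hat xi in s_gt0 *.
set m := Num.sqrt (rho / kappa).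
have m_gt0 : 0 < m by rewrite sqrtr_gt0 divr_gt0.
have m2 : kappa^-1 = m ^+ 2 / rho.
  by rewrite sqr_sqrtr ?divr_ge0 ?ltW//; field; rewrite !gt_eqF.
rewrite ler_pdivlMr//.
(* This gap minimises the closed form at [theta = 0], where its value is [(s + m) ^+ 2]. *)
have t_gt0 : 0 < s * m / rho by rewrite divr_gt0// mulr_gt0.
have := minimizer_shift_le (fun=> 0) Theta0 t_gt0.
rewrite spread0 mse0 m2 -/s.
have -> : (m ^+ 2 / rho + s * m / rho) * rho +
    (m ^+ 2 / rho + s * m / rho) / (s * m / rho) * s ^+ 2 = (s + m) ^+ 2.
  by field; rewrite !gt_eqF.
apply: le_trans; rewrite lerDl; apply: mean_ge0 => i.
by rewrite expr0n !mul0r mulr0 subr0 sqr_ge0.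
Qed.

End Minimizer.

End Regression.

(* The sample space is all of R^d * R.  The last hypothesis says that Theta is
   large enough for the constraint not to exclude small parameters: for
   Theta = [set 0] the claim ||theta|| >= delta_kappa > 0 is plainly false. *)
Theorem proposition2p3 (R : realType) (d n : nat) (rho kappa : R)
    (Theta : set 'cV[R]_d) (xi : 'I_n -> 'cV[R]_d * R)
    (n_gt0 : (0 < n)%N) (rho_gt0 : 0 < rho) (kappa_gt0 : 0 < kappa)
    (Theta_compact : compact Theta) (Theta_convex : convex_set Theta)
    (r_neq0 : r_hat xi != 0)
    (Theta_ball : forall theta : 'cV[R]_d,
       enorm theta <= delta_kappa rho kappa xi -> Theta theta) :
  forall (theta : 'cV[R]_d) (lambda : R),
    is_minimizer Theta (wdro_dual setT sq_loss (sq_cost kappa) rho xi)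
      theta lambda ->
    [/\ delta_kappa rho kappa xi <= enorm theta,
        kappa^-1 + delta_kappa rho kappa xi ^+ 2 <= lambda,
        0 < kappa^-1 + delta_kappa rho kappa xi ^+ 2 &
        lambda <= (sigma_y_hat xi + Num.sqrt (rho / kappa)) ^+ 2 / rho].
Proof.
move=> theta lambda minF; set delta := delta_kappa rho kappa xi.
have delta_ge0 : 0 <= delta.
  rewrite divr_ge0 ?enorm_ge0// !addr_ge0 ?opnorm_ge0 ?(ltW rho_gt0)//.
  by rewrite mulr_ge0// sqrtr_ge0.
have Theta0 : Theta 0 by apply: Theta_ball; rewrite enorm0.
have kV_gt0 : 0 < kappa^-1 by rewrite invr_gt0.
have th_ge : delta <= enorm theta by exact: minimizer_norm_ge minF Theta0 _ _.
split=> //.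
(* [spread theta <= lambda] turns the bound on the norm of [theta] into one on [lambda]. *)
- apply: le_trans (minimizer_spread_le n_gt0 kappa_gt0 minF Theta0).
  by rewrite lerD2l -sqr_enorm ler_sqr ?nnegrE ?enorm_ge0.
- by rewrite ltr_pwDl// sqr_ge0.
- exact: minimizer_lambda_le minF Theta0 _.
Qed.
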